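(* Let $n\ge 1$ be an integer and let $C_n=n2^n+1$. If $\phi(C_n)\mid C_n-1$, where $\phi$ denotes Euler's totient function, then $C_n$ is prime.
   Context: $C_n=n2^n+1$ is called the $n$th Cullen number. *)

(* Defs.v *)
From mathcomp Require Import all_boot.
Set Implicit Arguments. Unset Strict Implicit. Unset Printing Implicit Defensive.

Definition cullen (n : nat) : nat := n * 2 ^ n + 1.

(* Main.v *)
Require Import Defs.
From Stdlib Require Import NArith.
From mathcomp Require Import all_boot zify.

(** Put Y = n 2^n and suppose that Y + 1 is composite with phi(Y + 1) | Y.  Then
    Y + 1 is squarefree and every prime factor is p = m 2^b + 1 with m odd, the
    product of all these m dividing n.  Write n = q b + r with r < b.  Since
    m 2^b = -1 mod p, multiplying Y + 1 by m^q, resp. by m^(q+1) 2^(b-r), gives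
      p | n 2^r + (-1)^q m^q   and   p | n + (-1)^(q+1) m^(q+1) 2^(b-r).
    If one of these numbers is too small to be a nonzero multiple of p, it vanishes,
    which forces Y = (p - 1)^w with w odd.  At most one prime factor is of this kind,
    and w >= 3, so its cube is at most 8 Y.
    The other prime factors have a small product C: the Fermat primes among them are
    at most 2n and multiply to at most 4 n^2, and n^(2b) <= m^n for those with m >= 3,
    so that their exponents b sum to at most n/2.  This gives 8 C^3 <= Y^2, hence
    (Y + 1)^3 <= Y^3.  The estimates need n >= 324; below, 8 C^3 <= Y^2 is checked by
    enumerating the possible (m, b). *)

(** * Powers of x modulo x + 1 *)

Lemma expn_mod_succ (x k : nat) :
  0 < x -> x ^ k = (if odd k then x else 1) %[mod x.+1].
Proof.
move=> x_gt0.
have x2 : x ^ 2 = 1 %[mod x.+1].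
  have -> : x ^ 2 = x.-1 * x.+1 + 1 by rewrite expnS expn1; case: x x_gt0 => // x _ /=; nia.
  by rewrite modnMDl.
rewrite -{1}(odd_double_half k) -mul2n expnD [2 * _]mulnC mulnC [_ * 2]mulnC expnM -modnMml -modnXm x2 modnXm.
by rewrite exp1n modnMml mul1n; case: (odd k); rewrite ?expn1.
Qed.

Lemma dvdn_succ_expn (x k : nat) : 0 < x -> odd k -> x.+1 %| (x ^ k).+1.
Proof.
move=> x_gt0 k_odd.
by rewrite /dvdn -addn1 -modnDml expn_mod_succ // k_odd modnDml addn1 modnn.
Qed.

(** Since x is -1 modulo x + 1, the multiple is congruent to c + a or c - a by the parity of k. Both
    are below x + 1 in absolute value, so the residue must be 0; c + a > 0 rules out even k. *)
Lemma small_alternating (x a c k : nat) :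
  0 < x -> 0 < a -> x.+1 %| a * x ^ k + c -> a + c < x.+1 -> odd k /\ a = c.
Proof.
move=> x_gt0 a_gt0; rewrite /dvdn -modnDml -modnMmr expn_mod_succ // modnMmr modnDml.
case: (odd k) => /eqP h ltx; last first.
  by exfalso; move: h; rewrite muln1 modn_small //; lia.
split=> //; apply/eqP; rewrite eqn_leq; apply/andP.
have [le_ac|lt_ca] := leqP a c.
  have e : a * x + c = a * x.+1 + (c - a) by lia.
  by move: h; rewrite e modnMDl modn_small; lia.
have d : x.+1 %| a * x + c by apply/eqP.
have: x.+1 %| (a * x + c) + (a - c).
  have -> : (a * x + c) + (a - c) = a * x.+1 by lia.
  exact: dvdn_mull.
rewrite dvdn_addr //; case: (posnP (a - c)) => [ac0 _|gt0 /(dvdn_leq gt0)]; clear d h; lia.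
Qed.

(** * Prime factors for which a multiple must vanish *)

(** The sums bound the signed multiples of p in absolute value, so one test serves both parities of
    the exponent. *)
Definition tiny (n m b : nat) : bool :=
  (n * 2 ^ (n %% b) + m ^ (n %/ b) < (m * 2 ^ b).+1)
  || (n + m ^ (n %/ b).+1 * 2 ^ (b - n %% b) < (m * 2 ^ b).+1).

Lemma tiny_power (n m b : nat) : 0 < n -> 0 < m -> 0 < b ->
  (m * 2 ^ b).+1 %| (n * 2 ^ n).+1 -> tiny n m b ->
  exists2 w, odd w & (m * 2 ^ b) ^ w = n * 2 ^ n.
Proof.
move=> n_gt0 m_gt0 b_gt0; set x := m * 2 ^ b => dvdx.
have x_gt0 : 0 < x by rewrite muln_gt0 m_gt0 expn_gt0.
have nE := divn_eq n b; have r_lt := ltn_pmod n b_gt0.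
move: nE r_lt; rewrite /tiny -/x; set q := n %/ b; set r := n %% b => nE r_lt.
case/orP=> small.
- have [||w_odd e] := @small_alternating x (n * 2 ^ r) (m ^ q) q x_gt0 _ _ small.
  + by rewrite muln_gt0 n_gt0 expn_gt0.
  (* Multiplying by m^q turns 2^n = 2^(qb) 2^r into x^q 2^r. *)
  + have -> : n * 2 ^ r * x ^ q + m ^ q = m ^ q * (n * 2 ^ n).+1.
      rewrite {3}nE expnD [q * b]mulnC expnM mulnS /x expnMn.
      by move: (m ^ q) (2 ^ r) ((2 ^ b) ^ q) => u v w; nia.
    exact: dvdn_mull.
  exists q => //.
  rewrite expnMn -e {3}nE expnD -expnM [b * q]mulnC.
  by move: (2 ^ r) (2 ^ (q * b)) => u v; nia.
- have [|w_odd e] := @small_alternating x n (m ^ q.+1 * 2 ^ (b - r)) q.+1 x_gt0 n_gt0 _ small.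
  + have -> : n * x ^ q.+1 + m ^ q.+1 * 2 ^ (b - r)
            = m ^ q.+1 * 2 ^ (b - r) * (n * 2 ^ n).+1.
      rewrite expnMn -expnM.
      have -> : b * q.+1 = (b - r) + n by nia.
      by rewrite expnD; move: (m ^ q.+1) (2 ^ (b - r)) (2 ^ n) => u v w; nia.
    exact: dvdn_mull.
  exists q.+1 => //.
  rewrite expnMn -expnM.
  have -> : b * q.+1 = (b - r) + n by nia.
  by rewrite expnD mulnA -e.
Qed.

(** Cancelling gcd(w, v) leaves x^a = y^c with a, c coprime and odd, so x = z^c and y = z^a. Then z
    + 1 divides the primes x + 1 and y + 1, which forces z = x = y. *)
Lemma eq_base_odd_power (x y w v : nat) :
  prime x.+1 -> prime y.+1 -> odd w -> odd v -> x ^ w = y ^ v -> x = y.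
Proof.
move=> px py w_odd v_odd.
have x_gt0 : 0 < x by have := prime_gt1 px.
have y_gt0 : 0 < y by have := prime_gt1 py.
have d_gt0 : 0 < gcdn w v by rewrite gcdn_gt0 odd_gt0.
have [a wE] := dvdnP (dvdn_gcdl w v); have [c vE] := dvdnP (dvdn_gcdr w v).
have co : coprime a c.
  have := muln_gcdl a c (gcdn w v); rewrite -wE -vE /coprime => /eqP.
  by rewrite -{2}[gcdn w v]mul1n eqn_pmul2r.
have a_odd : odd a by move: w_odd; rewrite wE oddM => /andP[].
have c_odd : odd c by move: v_odd; rewrite vE oddM => /andP[].
move=> xy; have: (x ^ a) ^ gcdn w v == (y ^ c) ^ gcdn w v.
  by rewrite -!expnM -wE -vE xy.
rewrite eqn_exp2r // => /eqP e.
have a_gt0 := odd_gt0 a_odd; have c_gt0 := odd_gt0 c_odd.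
have [u s us _] := egcdnP c a_gt0.
have ua : u * a = s * c + 1 by rewrite us (eqP co).
(* With ua = sc + 1, the common root is z = y^u / x^s. *)
have dv : x ^ s %| y ^ u.
  rewrite -(dvdn_pexp2r _ _ a_gt0) -!expnM ua expnD expn1 [s * a]mulnC expnM e.
  by rewrite -expnM [c * s]mulnC dvdn_mulr.
have [z zE] := dvdnP dv.
have yE : y = z ^ a.
  apply/eqP; rewrite -(@eqn_pmul2r ((x ^ s) ^ a)) ?expn_gt0 ?x_gt0 //; apply/eqP.
  by rewrite -expnMn -zE -!expnM ua expnD expn1 [s * a]mulnC expnM e -expnM [c * s]mulnC mulnC.
have xE : x = z ^ c.
  by apply/eqP; rewrite -(eqn_exp2r _ _ a_gt0) e yE -!expnM mulnC.
have z_gt0 : 0 < z by case: z yE y_gt0 {xE zE} => // ->; rewrite exp0n.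
have key t k : prime t.+1 -> odd k -> t = z ^ k -> z = t.
  move=> pt k_odd tE; have := dvdn_succ_expn _ _ z_gt0 k_odd.
  rewrite -tE; case/primeP: pt => _ /[apply] /orP[/eqP[z0]|/eqP[->//]].
  by rewrite z0 in z_gt0.
by rewrite -(key x c) // -(key y a).
Qed.

(** * Fermat primes *)

Lemma fermat_of_prime (b : nat) : 0 < b -> prime (2 ^ b).+1 ->
  exists g, b = 2 ^ g.
Proof.
move=> b_gt0 pb; have bE := partnC 2 b_gt0.
have c_odd : odd b`_2^' by rewrite odd_2'nat part_pnat.
exists (logn 2 b).
have p1 : prime (2 ^ (2 ^ logn 2 b)).+1.
  have := dvdn_succ_expn (2 ^ 2 ^ logn 2 b) _ (expn_gt0 _ _) c_odd.
  rewrite -expnM -p_part bE; case/primeP: (pb) => _ /[apply] /orP[|/eqP->//].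
  by rewrite eqSS expn_eq0.
have e : 2 ^ b = (2 ^ 2 ^ logn 2 b) ^ b`_2^' by rewrite -expnM -p_part bE.
have := eq_base_odd_power _ _ 1 b`_2^' pb p1 isT c_odd; rewrite expn1 => /(_ e) /eqP.
by rewrite eqn_exp2l // => /eqP.
Qed.

Lemma prod_subset_leq (s t : seq nat) :
  uniq s -> {subset s <= t} -> all (leq 1) t ->
  \prod_(x <- s) x <= \prod_(x <- t) x.
Proof.
elim: s t => [|x s IH] t /=.
  move=> _ _ /allP t_gt0; rewrite big_nil big_seq.
  by apply: prodn_cond_gt0 => x /t_gt0.
move=> /andP[xs us] sub t_gt0.
have pt := perm_to_rem (sub x (mem_head x s)).
rewrite (perm_big _ pt) !big_cons leq_mul // IH //.
- move=> y ys; have := sub y; rewrite (perm_mem pt) !inE ys orbT => /(_ isT).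
  by case: eqP => // yx; rewrite -yx ys in xs.
- by move: t_gt0; rewrite (perm_all _ pt) => /andP[].
Qed.

(** Telescoping: (X - 1)(X + 1) + 1 = X^2 with X = 2^(2^g). *)
Lemma prod_fermat (g : nat) :
  (\prod_(p <- [seq (2 ^ 2 ^ i).+1 | i <- iota 0 g]) p).+1 = 2 ^ 2 ^ g.
Proof.
elim: g => [|g IH]; first by rewrite big_nil.
rewrite -[in iota 0 _]addn1 iotaD map_cat big_cat /= big_seq1 add0n.
rewrite [2 ^ g.+1]expnS mul2n -addnn expnD -IH; lia.
Qed.

(** For the least h with 2n <= 2^(2^h), only Fermat numbers of index below h occur. Their product is
    below 2^(2^h), the square of 2^(2^(h-1)) < 2n. *)
Lemma prod_bounded_fermat (n : nat) (s : seq nat) : 1 < n -> uniq s ->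
  (forall p, p \in s -> [/\ prime p, p <= 2 * n & exists2 b, 0 < b & p = (2 ^ b).+1]) ->
  \prod_(p <- s) p <= 4 * n ^ 2.
Proof.
move=> n_gt1 us sP.
have ex_g : exists g, 2 * n <= 2 ^ 2 ^ g.
  exists (2 * n); apply: ltnW; apply: (@ltn_trans (2 ^ (2 * n))); first exact: ltn_expl.
  by rewrite ltn_exp2l // ltn_expl.
have [g g_le g_min] := ex_minnP ex_g.
case: g g_le g_min => [|g] g_le g_min; first by lia.
have g_lt : 2 ^ 2 ^ g < 2 * n by rewrite ltnNge; apply/negP => /g_min; rewrite ltnn.
apply: (@leq_trans (2 ^ 2 ^ g.+1)); last first.
  by rewrite expnS mul2n -addnn expnD; nia.
rewrite -prod_fermat; apply: leqW; apply: prod_subset_leq => //.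
- move=> p /sP[pp p_le [b b_gt0 pE]].
  have [i bE] := fermat_of_prime b b_gt0 (etrans (congr1 _ (esym pE)) pp).
  apply/mapP; exists i; last by rewrite pE bE.
  rewrite mem_iota add0n /= -(@ltn_exp2l 2) // -(@ltn_exp2l 2) // -bE.
  by apply: leq_trans g_le; rewrite -pE.
- by apply/allP => p /mapP[i _ ->].
Qed.

(** * Squarefreeness from the totient condition *)

(** A prime whose square divides m divides the totient, hence both m - 1 and m. *)
Lemma lehmer_squarefree (m : nat) : 0 < m -> totient m %| m.-1 ->
  \prod_(p <- primes m) p = m /\ \prod_(p <- primes m) p.-1 = totient m.
Proof.
move=> m_gt0 dv.
have sq p : p \in primes m -> logn p m = 1.
  move=> pm; apply/eqP; rewrite eqn_leq logn_gt0 pm andbT leqNgt; apply/negP => gt1.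
  move: (pm); rewrite mem_primes => /and3P[pp _ dp].
  have dt : p %| totient m.
    rewrite totientE // (big_rem p) //= dvdn_mulr // dvdn_mull //.
    by rewrite -subn1 dvdn_exp // subn_gt0.
  have := dvdn_trans dt dv; rewrite -subn1 dvdn_subr // dvdn1 => /eqP p1.
  by rewrite p1 in pp.
split.
  rewrite [RHS]prod_prime_decomp // prime_decompE big_map /= big_seq [RHS]big_seq.
  by apply: eq_bigr => p /sq ->; rewrite expn1.
rewrite totientE // big_seq [RHS]big_seq.
by apply: eq_bigr => p /sq ->; rewrite muln1.
Qed.

(** * Size constraints on factors that are not tiny *)

Lemma not_tiny_fermat (n b : nat) : 0 < n -> 0 < b -> ~~ tiny n 1 b -> 2 ^ b < 2 * n.
Proof.
move=> n_gt0 b_gt0; rewrite /tiny negb_or !exp1n !mul1n -!leqNgt => /andP[].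
have r_lt := ltn_pmod n b_gt0.
have [->|r_gt0] := posnP (n %% b); first by rewrite expn0; lia.
move=> _; have : 2 ^ (b - n %% b) <= 2 ^ b.-1 by rewrite leq_exp2l //; lia.
have -> : 2 ^ b = 2 * 2 ^ b.-1 by rewrite -expnS prednK.
lia.
Qed.

(** Here l is the bit length of n. The threshold is 324 = 4 * 9^2, which settles l <= 9; beyond,
    2^(l-1) outgrows both bounds. *)
Lemma sqr_log_bound (n : nat) : 324 <= n ->
  exists l, [/\ n < 2 ^ l, 4 * l ^ 2 <= n & 18 + 20 * l <= n].
Proof.
move=> n_ge; exists (trunc_log 2 n).+1.
have lo : 2 ^ trunc_log 2 n <= n by apply: trunc_logP => //; lia.
split; first exact: trunc_log_ltn.
all: have [l_le|l_gt] := leqP (trunc_log 2 n) 8; first by nia.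
all: apply: leq_trans lo; move: l_gt; move: (trunc_log 2 n) => k.
all: move=> /subnKC <-; elim: (k - 9) => // j IH.
all: by rewrite addnS (expnS _ (9 + j)); nia.
Qed.

Lemma not_tiny_bound (n m b : nat) : 324 <= n -> 2 < m -> 0 < b ->
  ~~ tiny n m b -> n ^ (2 * b) <= m ^ n.
Proof.
move=> n_ge m_gt2 b_gt0; apply: contraR; rewrite -ltnNge => mn.
have [l [n_lt l2 _]] := sqr_log_bound n n_ge.
have nE := divn_eq n b; have r_lt := ltn_pmod n b_gt0.
rewrite /tiny; move: nE r_lt; set q := n %/ b; set r := n %% b => nE r_lt.
have u_lt : m ^ q < n ^ 2.
  rewrite -(ltn_exp2r _ _ b_gt0) -!expnM; apply: leq_ltn_trans mn.
  by rewrite leq_exp2l; lia.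
(* From 8^n <= m^(2n) < n^(4b) <= 2^(4bl) follows 3n < 4bl, while b < 3l would give 4bl <= 12 l^2 <=
   3n. *)
have lb : 3 * l <= b.
  rewrite leqNgt; apply/negP => b_lt.
  suff : 3 * n < 4 * (b * l) by nia.
  rewrite -(@ltn_exp2l 2) //.
  apply: (@leq_ltn_trans (m ^ n * m ^ n)).
    by rewrite expnM -expnMn leq_exp2r; nia.
  apply: (@leq_trans (n ^ (2 * b) * n ^ (2 * b))); first by rewrite ltn_mul.
  rewrite -expnD [4 * _](_ : _ = l * (2 * b + 2 * b)); last by lia.
  by rewrite expnM leq_exp2r //; lia.
have n3 : n ^ 3 <= 2 ^ b.
  apply: (@leq_trans (2 ^ (3 * l))); last by rewrite leq_exp2l.
  by rewrite mulnC expnM leq_exp2r // ltnW.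
have bE : 2 ^ b = 2 ^ (b - r) * 2 ^ r by rewrite -expnD subnK // ltnW.
have r1 : 0 < 2 ^ r by rewrite expn_gt0.
(* Either n 2^r <= 2^b, making the first sum small, or 2^(b-r) < n, so that the second is at most m
   n^3. *)
have [n_le|n_gt] := leqP n (2 ^ (b - r)); apply/orP; [left|right].
  have : n * 2 ^ r <= 2 ^ b by rewrite bE leq_mul2r n_le orbT.
  move: n3 u_lt; rewrite !expnS expn0 muln1.
  by move: (m ^ q) (n * 2 ^ r) (2 ^ b) => u v w; nia.
rewrite ltnS expnS; apply: (@leq_trans (m * n ^ 3)); last by rewrite leq_mul2l n3 orbT.
move: u_lt n_gt; move: (m ^ q) (2 ^ (b - r)) => u t u_lt n_gt.
have ut : u * t <= (n ^ 2).-1 * n.-1 by apply: leq_mul; lia.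
apply: (@leq_trans (n + m * ((n ^ 2).-1 * n.-1))).
  by rewrite leq_add2l -mulnA leq_mul2l ut orbT.
move: n_ge m_gt2; clear; move=> n_ge m_gt2.
case: n n_ge => // n n_ge; rewrite [n.+1.-1]succnK.
have -> : (n.+1 ^ 2).-1 = n * (n + 2) by rewrite -mulnn; lia.
have -> : n.+1 ^ 3 = n * (n + 2) * n + (n ^ 2 + 3 * n + 1) by rewrite !expnS expn0; lia.
by rewrite -mulnn; nia.
Qed.

(** * The product of the factors that are not tiny, n >= 324 *)

(** In p = m 2^b + 1, [core p] is m and [level p] is b. *)
Definition core (p : nat) : nat := p.-1`_2^'.
Definition level (p : nat) : nat := logn 2 p.-1.

Lemma core_level (p : nat) : 1 < p -> p = (core p * 2 ^ level p).+1.
Proof.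
by case: p => [|[|p]] // _; rewrite /core /level mulnC -p_part partnC.
Qed.

Lemma partn_prod (pi : nat_pred) (s : seq nat) (f : nat -> nat) :
  (forall x, x \in s -> 0 < f x) ->
  (\prod_(x <- s) f x)`_pi = \prod_(x <- s) (f x)`_pi.
Proof.
elim: s => [|x s IH] f_gt0; first by rewrite !big_nil partn1.
have fs_gt0 y : y \in s -> 0 < f y by move=> ys; rewrite f_gt0 // inE ys orbT.
rewrite !big_cons partnM ?IH ?f_gt0 ?mem_head // big_seq.
exact: prodn_cond_gt0.
Qed.

Lemma prodn_exp (s : seq nat) (f : nat -> nat) (k : nat) :
  \prod_(x <- s) f x ^ k = (\prod_(x <- s) f x) ^ k.
Proof. by rewrite (big_morph (expn^~ k) (fun x y => expnMn x y k) (exp1n k)). Qed.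

Lemma prod_not_tiny_large (n : nat) (s : seq nat) : 324 <= n -> uniq s ->
  (forall p, p \in s ->
    [/\ prime p, 0 < level p, odd (core p) & ~~ tiny n (core p) (level p)]) ->
  \prod_(p <- s) core p <= n ->
  8 * (\prod_(p <- s) p) ^ 3 <= (n * 2 ^ n) ^ 2.
Proof.
move=> n_ge us sP core_le.
set f := [seq p <- s | core p == 1]; set g := [seq p <- s | core p != 1].
have split_s h : \prod_(p <- s) h p = \prod_(p <- f) h p * \prod_(p <- g) h p.
  by rewrite !big_filter; exact: bigID.
have f_le : \prod_(p <- f) p <= 4 * n ^ 2.
  apply: prod_bounded_fermat; [lia | exact: filter_uniq |].
  move=> p; rewrite mem_filter => /andP[/eqP c1 /sP[pp lp _]].
  have := core_level p (prime_gt1 pp); rewrite c1 mul1n => pE nt.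
  split=> //; last by exists (level p).
  by rewrite pE; apply: not_tiny_fermat => //; lia.
have gP p : p \in g -> [/\ 1 < p, 2 < core p & n ^ (2 * level p) <= core p ^ n].
  rewrite mem_filter => /andP[c1 /sP[pp lp oc nt]].
  have c_gt2 : 2 < core p by case: (core p) c1 oc => [|[|[|]]].
  by split; rewrite ?prime_gt1 //; apply: not_tiny_bound.
have g_core : \prod_(p <- g) core p <= n.
  apply: leq_trans core_le.
  rewrite [leqRHS]split_s.
  apply: leq_pmull; rewrite big_seq; apply: prodn_cond_gt0 => p.
  by rewrite mem_filter => /andP[/eqP->].
set e := \sum_(p <- g) level p.
have g_le : \prod_(p <- g) p <= n ^ 2 * 2 ^ e.
  (* Squaring the core absorbs the + 1 in p. *)
  apply: (@leq_trans (\prod_(p <- g) (core p ^ 2 * 2 ^ level p))).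
    rewrite big_seq [leqRHS]big_seq; apply: leq_prod => p /gP[p_gt1 c_gt2 _].
    rewrite {1}(core_level p p_gt1) -mulnn.
    have : 0 < 2 ^ level p by rewrite expn_gt0.
    by move: (core p) (2 ^ level p) c_gt2 => c w; nia.
  by rewrite big_split /= -expn_sum leq_mul2r prodn_exp leq_exp2r // g_core orbT.
(* Multiplying the bounds n^(2b) <= m^n gives n^(2e) <= n^n. *)
have e_le : 2 * e <= n.
  rewrite -(@leq_exp2l n); last by lia.
  apply: (@leq_trans ((\prod_(p <- g) core p) ^ n)); last by rewrite leq_exp2r; lia.
  rewrite /e big_distrr /= expn_sum -prodn_exp big_seq [leqRHS]big_seq.
  by apply: leq_prod => p /gP[].
have [l [n_lt _ n_ge2]] := sqr_log_bound n n_ge.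
rewrite split_s.
move: f_le g_le; move: (\prod_(p <- f) p) (\prod_(p <- g) p) => F G f_le g_le.
have FG : F * G <= 4 * n ^ 2 * (n ^ 2 * 2 ^ e) by apply: leq_mul.
have FG3 : (F * G) ^ 3 <= (4 * n ^ 2 * (n ^ 2 * 2 ^ e)) ^ 3 by rewrite leq_exp2r.
apply: leq_trans (leq_mul (leqnn 8) FG3) _.
have -> : 8 * (4 * n ^ 2 * (n ^ 2 * 2 ^ e)) ^ 3 = n ^ 2 * (2 ^ 9 * n ^ 10 * 2 ^ (e * 3)).
  rewrite (expnM n 2 5) (expnM 2 e 3) (expnD 2 3 6) (expnM 2 2 3).
  move: (n ^ 2) (2 ^ e) => u w; rewrite !expnMn.
  have : u * u ^ 5 = u ^ 3 * u ^ 3 by rewrite -expnS -expnD.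
  by move: (u ^ 5) (u ^ 3) (w ^ 3) ((2 ^ 2) ^ 3) => u5 u3 w3 c uE; nia.
rewrite [leqRHS]expnMn leq_mul2l; apply/orP; right.
have n10 : n ^ 10 <= 2 ^ (l * 10) by rewrite expnM leq_exp2r // ltnW.
(* The exponent is at most 2n, as 3e <= 3n/2 and 9 + 10l <= n/2. *)
apply: (@leq_trans (2 ^ (9 + l * 10 + e * 3))).
  by rewrite !expnD leq_mul2r leq_mul2l n10 !orbT.
by rewrite -expnM leq_exp2l //; lia.
Qed.

(** * Enumeration in binary arithmetic for n < 324 *)

(* A sufficient condition for [tiny] in terms of bit lengths. *)
Definition tinyN (n m b : N) : bool :=
  let q := (n / b)%num in
  let r := (n mod b)%num in
  let k := N.size n in
  let l := N.size m in
  (((r + k <? b) && (q * l <? b)) || ((k <? b) && (q * l <? r)))%num.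

(** A superset of the prime factors that are not tiny: primality is not tested. The bound n + 8 on b
    covers n + v_2(n), since n < 2^9. *)
Definition candidates (n : nat) : seq N :=
  let k := N.of_nat n in
  let c := N.succ (N.shiftl k k) in
  [seq x <- [seq N.succ (N.shiftl m b)
            | m <- [seq m <- map N.of_nat (iota 1 n) | N.odd m && (k mod m =? 0)%num],
              b <- [seq b <- map N.of_nat (iota 1 (n + 8)) | ~~ tinyN k m b]]
  | (c mod x =? 0)%num].

Definition candidates_small (n : nat) : bool :=
  let k := N.of_nat n in
  (8 * foldr N.mul 1 (candidates n) ^ 3 <=? N.shiftl k k ^ 2)%num.

Lemma of_nat_exp (a b : nat) : N.of_nat (a ^ b) = (N.of_nat a ^ N.of_nat b)%num.
Proof.
rewrite -Nat2N.inj_pow; congr N.of_nat.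
by elim: b => // b IH; rewrite expnS IH.
Qed.

Lemma of_nat_shiftl (a b : nat) :
  N.of_nat (a * 2 ^ b) = N.shiftl (N.of_nat a) (N.of_nat b).
Proof. by rewrite N.shiftl_mul_pow2 Nat2N.inj_mul of_nat_exp. Qed.

Lemma of_nat_divn (a b : nat) : 0 < b ->
  N.of_nat (a %/ b) = (N.of_nat a / N.of_nat b)%num /\
  N.of_nat (a %% b) = (N.of_nat a mod N.of_nat b)%num.
Proof.
move=> b_gt0; have aE := divn_eq a b; have r_lt := ltn_pmod a b_gt0.
have r_ltN : (N.of_nat (a %% b) < N.of_nat b)%num.
  by move: (a %% b) r_lt; clear; lia.
have aEN : N.of_nat a = (N.of_nat b * N.of_nat (a %/ b) + N.of_nat (a %% b))%num.
  by rewrite -Nat2N.inj_mul -Nat2N.inj_add; congr N.of_nat; rewrite {1}aE mulnC.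
by split; [apply: N.div_unique aEN | apply: N.mod_unique aEN].
Qed.

Lemma of_nat_size (n : nat) :
  exists2 k, N.size (N.of_nat n) = N.of_nat k & n < 2 ^ k.
Proof.
exists (N.to_nat (N.size (N.of_nat n))); first by rewrite N2Nat.id.
have := N.size_gt (N.of_nat n); move: (N.size _) => k.
rewrite -{1}[k]N2Nat.id -[2%num]/(N.of_nat 2) -of_nat_exp.
by move: (2 ^ _) => x; lia.
Qed.

(** With n < 2^k and m < 2^l, each summand of the relevant sum is at most m 2^(b-1). *)
Lemma tinyN_of_nat (n m b : nat) : 0 < m -> 0 < b ->
  tinyN (N.of_nat n) (N.of_nat m) (N.of_nat b) -> tiny n m b.
Proof.
move=> m_gt0 b_gt0; have [qE rE] := of_nat_divn n b b_gt0.
have r_lt := ltn_pmod n b_gt0.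
rewrite /tinyN /tiny -qE -rE; move: (n %/ b) (n %% b) r_lt {qE rE} => q r r_lt.
have [k -> n_lt] := of_nat_size n; have [l -> m_lt] := of_nat_size m.
have mq : m ^ q <= 2 ^ (q * l).
  have [->|q_gt0] := posnP q; first by rewrite mul0n.
  by rewrite mulnC expnM leq_exp2r // ltnW.
have bE : 2 ^ b = 2 * 2 ^ b.-1 by rewrite -expnS prednK.
case/orP=> /andP[]; rewrite -Nat2N.inj_mul -?Nat2N.inj_add => h1 h2.
- have ql_le : 2 ^ (q * l) <= 2 ^ b.-1 by rewrite leq_exp2l //; lia.
  have rk_le : 2 ^ (k + r) <= 2 ^ b.-1 by rewrite leq_exp2l //; lia.
  have nr : n * 2 ^ r <= 2 ^ (k + r) by rewrite expnD leq_mul2r ltnW ?orbT.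
  by apply/orP; left; rewrite bE; nia.
- have k_le : 2 ^ k <= 2 ^ b.-1 by rewrite leq_exp2l //; lia.
  have ql_le : 2 ^ (q * l + (b - r)) <= 2 ^ b.-1 by rewrite leq_exp2l //; lia.
  have mr : m ^ q * 2 ^ (b - r) <= 2 ^ (q * l + (b - r)) by rewrite expnD leq_mul2r mq orbT.
  by apply/orP; right; rewrite bE expnS -mulnA; nia.
Qed.

Lemma mem_candidates (n m b : nat) :
  0 < m <= n -> 0 < b <= n + 8 -> odd m -> m %| n -> ~~ tiny n m b ->
  (m * 2 ^ b).+1 %| (n * 2 ^ n).+1 ->
  N.of_nat (m * 2 ^ b).+1 \in candidates n.
Proof.
move=> m_bd b_bd m_odd m_dvd nt dv.
have m_gt0 : 0 < m by lia. have b_gt0 : 0 < b by lia.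
rewrite mem_filter; apply/andP; split.
  by rewrite -of_nat_shiftl -Nat2N.inj_succ -(of_nat_divn _ _ (ltn0Sn _)).2 (eqP dv).
rewrite Nat2N.inj_succ of_nat_shiftl.
apply: (allpairs_f_dep (fun m b => N.succ (N.shiftl m b))).
  rewrite mem_filter map_f ?mem_iota ?andbT; last by lia.
  rewrite -(of_nat_divn _ _ m_gt0).2 (eqP m_dvd) andbT.
  have -> : N.of_nat m = (2 * N.of_nat m./2 + 1)%num by lia.
  exact: N.odd_odd.
rewrite mem_filter map_f ?mem_iota ?andbT; last by lia.
by apply: contra nt; apply: tinyN_of_nat.
Qed.

Lemma foldr_mulN (s : seq N) :
  N.to_nat (foldr N.mul 1%num s) = \prod_(x <- map N.to_nat s) x.
Proof.
by elim: s => [|x s IH]; rewrite ?big_nil //= big_cons N2Nat.inj_mul IH.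
Qed.

Lemma candidates_smallP (n : nat) : candidates_small n ->
  8 * (\prod_(x <- map N.to_nat (candidates n)) x) ^ 3 <= (n * 2 ^ n) ^ 2.
Proof.
rewrite /candidates_small -foldr_mulN -of_nat_shiftl.
rewrite -{1}[foldr _ _ _]N2Nat.id.
rewrite -[3%num]/(N.of_nat 3) -[2%num]/(N.of_nat 2) -!of_nat_exp -[8%num]/(N.of_nat 8).
by rewrite -Nat2N.inj_mul; move: (_ ^ 3) (_ ^ 2) => u v; lia.
Qed.

(** Every factor is a candidate and all candidates are positive, so extra candidates only enlarge
    the product. *)
Lemma prod_not_tiny_small (n : nat) (s : seq nat) : candidates_small n -> uniq s ->
  (forall p, p \in s ->
    [/\ p = (core p * 2 ^ level p).+1, 0 < core p <= n /\ 0 < level p <= n + 8,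
        odd (core p), core p %| n /\ ~~ tiny n (core p) (level p)
      & p %| (n * 2 ^ n).+1]) ->
  8 * (\prod_(p <- s) p) ^ 3 <= (n * 2 ^ n) ^ 2.
Proof.
move=> small us sP; apply: leq_trans (candidates_smallP n small).
rewrite leq_mul2l leq_exp2r //; apply: prod_subset_leq => //.
  move=> p /sP[pE [c_bd l_bd] c_odd [c_dvd nt] dv].
  apply/mapP; exists (N.of_nat p); last by rewrite Nat2N.id.
  by rewrite pE; apply: mem_candidates => //; rewrite -pE.
apply/allP => _ /mapP[x xc ->]; move: xc; rewrite mem_filter => /andP[_].
by case/allpairsPdep => m [b [_ _ ->]]; lia.
Qed.

(* The bound really fails for n = 0, 1, 2, 3 and 6. *)
Lemma candidates_small_all :
  all (fun n => (n \in [:: 0; 1; 2; 3; 6]) || candidates_small n) (iota 0 324).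
Proof. by vm_cast_no_check (erefl true). Qed.

Lemma candidates_small_lt324 (n : nat) :
  n < 324 -> n \notin [:: 0; 1; 2; 3; 6] -> candidates_small n.
Proof.
move=> n_lt /negbTE n_in; have n_iota : n \in iota 0 324 by rewrite mem_iota.
have := allP candidates_small_all n n_iota.
rewrite n_in.
exact: id.
Qed.

(** * Prime factors of a Cullen number *)

Lemma cullen_odd_part (n : nat) : 0 < n -> (n * 2 ^ n)`_2^' %| n.
Proof.
move=> n_gt0; rewrite partnM ?expn_gt0 // [X in _ * X]part_p'nat ?muln1 ?dvdn_part //.
by rewrite pnatNK pnatX pnat_id.
Qed.

(** Since p - 1 divides the totient, it divides n 2^n; odd parts and 2-adic valuations are then
    compared. *)
Lemma cullen_factor (n p : nat) : 0 < n -> totient (n * 2 ^ n).+1 %| n * 2 ^ n ->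
  p \in primes (n * 2 ^ n).+1 ->
  [/\ prime p, 0 < core p <= n /\ 0 < level p <= logn 2 n + n, odd (core p),
      core p %| n & p %| (n * 2 ^ n).+1].
Proof.
move=> n_gt0 dv pin.
have [_ totE] := lehmer_squarefree _ (ltn0Sn _) dv.
move: (pin); rewrite mem_primes => /and3P[pp _ dp].
have y_gt0 : 0 < n * 2 ^ n by rewrite muln_gt0 n_gt0 expn_gt0.
have dp1 : p.-1 %| n * 2 ^ n.
  by apply: dvdn_trans dv; rewrite -totE (big_rem p) //= dvdn_mulr.
have c_dvd : core p %| n.
  by apply: dvdn_trans (cullen_odd_part n n_gt0); apply: partn_dvd.
have p_odd : odd p.
  case: (even_prime pp) => // p2; move: dp.
  rewrite p2 dvdn2 /= oddM oddX /= orbF.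
  by case: n n_gt0 {dv pin totE y_gt0 dp1 c_dvd} => // n _; rewrite andbF.
have p1_gt0 : 0 < p.-1 by have := prime_gt1 pp; lia.
split=> //; last by rewrite odd_2'nat part_pnat.
split; first by rewrite part_gt0 dvdn_leq.
rewrite /level logn_gt0 mem_primes p1_gt0 dvdn2 /=.
have -> : odd p.-1 = false by move: p_odd; rewrite -{1}(prednK (prime_gt0 pp)) /= => /negbTE.
apply: leq_trans (dvdn_leq_log 2 y_gt0 dp1) _.
by rewrite lognM ?expn_gt0 // pfactorK.
Qed.

Lemma prod_tiny (n : nat) (s : seq nat) : 0 < n -> ~~ prime (n * 2 ^ n).+1 ->
  uniq s ->
  (forall p, p \in s -> [/\ prime p, 0 < level p, 0 < core p,
     p %| (n * 2 ^ n).+1 & tiny n (core p) (level p)]) ->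
  (\prod_(p <- s) p) ^ 3 <= 8 * (n * 2 ^ n).
Proof.
move=> n_gt0 comp us sP.
have y_gt0 : 0 < n * 2 ^ n by rewrite muln_gt0 n_gt0 expn_gt0.
have spec p : p \in s -> exists2 w, odd w & p.-1 ^ w = n * 2 ^ n.
  move=> /sP[pp l_gt0 c_gt0 dv ti]; have pE := core_level p (prime_gt1 pp).
  rewrite pE succnK; apply: tiny_power => //; by rewrite -pE.
case: s us sP spec => [|p [|p' s]] us sP spec.
- by rewrite big_nil; lia.
- rewrite big_seq1; have [pp _ _ _ _] := sP p (mem_head _ _).
  have [w w_odd pw] := spec p (mem_head _ _).
  have p_gt1 := prime_gt1 pp; have pK : p.-1.+1 = p by rewrite prednK ?prime_gt0.
  (* If w = 1, then p = Y + 1 would be prime. *)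
  have w_gt2 : 2 < w.
    case: w w_odd pw => [|[|[|w]]] // _; rewrite expn1 => pE.
    by rewrite -pE pK pp in comp.
  (* The factor 8 comes from p <= 2(p - 1). *)
  apply: (@leq_trans (8 * p.-1 ^ 3)).
    rewrite -[8]/(2 ^ 3) -expnMn leq_exp2r //; lia.
  by rewrite leq_mul2l -pw leq_pexp2l //; lia.
- have [pp _ _ _ _] := sP p (mem_head _ _).
  have p'_in : p' \in p :: p' :: s by rewrite !inE eqxx orbT.
  have [pp' _ _ _ _] := sP p' p'_in.
  have [w w_odd pw] := spec p (mem_head _ _).
  have [w' w'_odd pw'] := spec p' p'_in.
  have e : p.-1 = p'.-1.
    by apply: (eq_base_odd_power _ _ w w'); rewrite ?prednK ?prime_gt0 // pw pw'.
  have ep : p = p' by rewrite -(prednK (prime_gt0 pp)) e prednK ?prime_gt0.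
  by move: us; rewrite ep /= inE eqxx.
Qed.

(** * Comparison of the cubes of Y + 1 and Y *)

Theorem theorem1 (n : nat) (hn : 1 <= n)
  (hdiv : totient (cullen n) %| cullen n - 1) : prime (cullen n).
Proof.
apply/negPn/negP => comp.
have n_in : n \notin [:: 0; 1; 2; 3; 6].
  (* C_1 = 3 is prime; for 9, 25 and 385 the totients 6, 20 and 240 do not divide 8, 24 and 384. *)
  apply/negP; rewrite !inE => /or4P[/eqP n0|/eqP n1|/eqP n2|/orP[/eqP n3|/eqP n6]].
  - by rewrite n0 in hn.
  - by rewrite n1 in comp.
  - by rewrite n2 in hdiv.
  - by rewrite n3 in hdiv.
  - by move: hdiv; rewrite n6; vm_compute.
move: hdiv comp; rewrite /cullen addnK addn1 => dv comp.
have [prodE totE] := lehmer_squarefree _ (ltn0Sn _) dv.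
have factor := cullen_factor n _ hn dv.
have y_gt0 : 0 < n * 2 ^ n by rewrite muln_gt0 hn expn_gt0.
set ps := primes _ in prodE totE factor.
have ups : uniq ps := primes_uniq _.
set t := [seq p <- ps | tiny n (core p) (level p)].
set s := [seq p <- ps | ~~ tiny n (core p) (level p)].
have split_ps h : \prod_(p <- ps) h p = \prod_(p <- t) h p * \prod_(p <- s) h p.
  by rewrite !big_filter; exact: bigID.
have t_le : (\prod_(p <- t) p) ^ 3 <= 8 * (n * 2 ^ n).
  apply: prod_tiny => //; first exact: filter_uniq.
  by move=> p; rewrite mem_filter => /andP[ti /factor[pp [/andP[? _] /andP[? _]] _ _ dp]].
have s_le : 8 * (\prod_(p <- s) p) ^ 3 <= (n * 2 ^ n) ^ 2.
  have [n_ge|n_lt] := leqP 324 n.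
    apply: prod_not_tiny_large => //; first exact: filter_uniq.
      move=> p; rewrite mem_filter => /andP[nt /factor[pp [_ /andP[l_gt0 _]] c_odd _ _]].
      by split.
    have core_gt0 p : 0 < core p by rewrite part_gt0.
    apply: (@leq_trans (\prod_(p <- ps) core p)).
      by rewrite split_ps leq_pmull // prodn_gt0.
    (* The cores multiply to the odd part of the totient, which divides that of Y and hence n. *)
    have -> : \prod_(p <- ps) core p = (totient (n * 2 ^ n).+1)`_2^'.
      rewrite -totE partn_prod // => p /factor[/prime_gt1]; lia.
    apply: dvdn_leq => //; apply: dvdn_trans (partn_dvd 2^' y_gt0 dv) _.
    exact: cullen_odd_part.
  apply: prod_not_tiny_small; [exact: candidates_small_lt324 | exact: filter_uniq |].
  move=> p; rewrite mem_filter => /andP[nt /factor[pp [c_bd /andP[l_gt0 l_le]] c_odd c_dvd dp]].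
  split=> //; first by apply: core_level; apply: prime_gt1.
  (* Here 2^(v_2(n)) <= n < 324 < 2^9. *)
  split=> //; rewrite l_gt0 (leq_trans l_le) // addnC leq_add2l -ltnS.
  rewrite -(@ltn_exp2l 2) // -p_part; apply: leq_ltn_trans (dvdn_leq hn (dvdn_part _ _)) _.
  by apply: ltn_trans n_lt _.
have : (n * 2 ^ n).+1 ^ 3 <= (n * 2 ^ n) ^ 3.
  rewrite -{1}prodE split_ps expnMn -(@leq_pmul2l 8) // mulnCA.
  apply: leq_trans (leq_mul t_le s_le) _.
  by rewrite -mulnA -expnS.
by rewrite leq_exp2r // ltnn.
Qed.
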